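(* If $G$ is a subcubic graph (a finite simple graph with maximum degree at most $3$), then $\operatorname{tlir}(G) \leq 2$.
   Context: A total coloring of $G$ assigns a color to every vertex and every edge of $G$. For a color $c$ and a vertex $v$, the total $c$-degree of $v$ is the number of edges of color $c$ incident to $v$, plus $1$ if $v$ itself has color $c$. A total coloring is a locally irregular total coloring (TLIR coloring) if for every edge $uv$, with $c$ the color of $uv$, the total $c$-degrees of $u$ and $v$ differ. $\operatorname{tlir}(G)$ is the minimum number of colors in a TLIR coloring of $G$. *)

(* Defs.v *)
From mathcomp Require Import all_boot.

Set Implicit Arguments.
Unset Strict Implicit.
Unset Printing Implicit Defensive.

Record sgraph := SGraph {
  vertex :> finType;
  edges : {set {set vertex}};
  edges_card2 : forall e, e \in edges -> #|e| = 2
}.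

Definition edge (G : sgraph) := {e : {set G} | e \in edges G}.

Definition degree (G : sgraph) (v : G) : nat :=
  #|[set e : edge G | v \in val e]|.

Definition max_degree (G : sgraph) : nat := \max_(v : G) degree v.

Definition subcubic (G : sgraph) : bool := max_degree G <= 3.

Definition total_coloring (G : sgraph) (k : nat) := {ffun G + edge G -> 'I_k}.

Definition total_cdegree (G : sgraph) (k : nat) (f : total_coloring G k)
    (c : 'I_k) (v : G) : nat :=
  #|[set e : edge G | (v \in val e) && (f (inr e) == c)]| + (f (inl v) == c).

Definition is_tlir (G : sgraph) (k : nat) (f : total_coloring G k) : bool :=
  [forall e : edge G, forall u : G, forall v : G,
    (val e == [set u; v]) ==>
      (total_cdegree f (f (inr e)) u != total_cdegree f (f (inr e)) v)].

Definition has_tlir (G : sgraph) (k : nat) : bool :=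
  [exists f : total_coloring G k, is_tlir f].

(* #|G| colors always suffice: give the vertices distinct colors and each edge
   the color of one of its endpoints. *)
Lemma has_tlir_ex (G : sgraph) : exists k, has_tlir G k.
Proof.
have w_ex (e : edge G) : {w : G | w \in val e}.
  apply: sigW; apply/card_gt0P.
  by rewrite (edges_card2 (valP e)).
pose m (e : edge G) : G := sval (w_ex e).
have mP e : m e \in val e := svalP (w_ex e).
exists #|G|; apply/existsP.
pose g (x : G + edge G) : 'I_#|G| :=
  match x with inl v => enum_rank v | inr e => enum_rank (m e) end.
exists (finfun g : total_coloring G #|G|).
have key (e : edge G) (u v : G) : val e = [set u; v] -> m e = u ->
    total_cdegree (finfun g : total_coloring G #|G|) (enum_rank (m e)) v
    < total_cdegree (finfun g : total_coloring G #|G|) (enum_rank (m e)) u.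
  move=> e_uv me.
  have neq_uv : u != v.
    by apply/eqP=> uv; have := edges_card2 (valP e); rewrite e_uv uv setUid cards1.
  rewrite /total_cdegree !ffunE /= me eqxx (inj_eq enum_rank_inj).
  rewrite eq_sym (negPf neq_uv) addn0 addn1 ltnS.
  apply: subset_leq_card; apply/subsetP => d; rewrite !inE ffunE /=.
  rewrite (inj_eq enum_rank_inj) => /andP[_ /eqP md].
  by have := mP d; rewrite md eqxx => ->.
apply/forallP=> e; apply/forallP=> u; apply/forallP=> v; apply/implyP=> /eqP e_uv.
rewrite ffunE /=; have := mP e; rewrite e_uv => /set2P[me|me].
  by rewrite gtn_eqF // (key e u v).
by rewrite ltn_eqF // (key e v u) // e_uv setUC.
Qed.

Definition tlir (G : sgraph) : nat := ex_minn (has_tlir_ex G).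

(* Main.v *)
Require Import Defs.
From mathcomp Require Import all_boot.
From mathcomp Require Import zify.

Set Implicit Arguments.
Unset Strict Implicit.
Unset Printing Implicit Defensive.

(* Take a proper vertex coloring c minimizing the sum of c(v) (deg v + 1).  It
   uses the classes 0, 1, 2, 3, every vertex has a neighbor in each lower class,
   and (by an exchange argument) a vertex of class 2 and degree 3 with only one
   neighbor in class 0 has that neighbor of degree 3.  Color red the edges that
   meet class 0 or join classes 2 and 3, and blue the others, which form paths
   and cycles.  The vertex colors are chosen so that the ends of a blue edge have
   different blue totals in {1, 2, 3}, that vertices outside class 0 have red
   total at most 3, and those of class 0 have red total 4 (degree 3) or 2
   (smaller degree).  The only remaining conflicts are at vertices of red total 2
   with a class 0 neighbor of degree at most 2; switching that edge and the
   vertex itself to blue gives the vertex blue total 3, and its class 0 neighbor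
   has blue total at most 2. *)

Section Relation.

Variables (T : finType) (adj : rel T).
Hypotheses (adj_sym : symmetric adj) (adj_irr : irreflexive adj).

(** * Proper colorings of minimum weight *)

Definition deg (v : T) : nat := \sum_(w | adj v w) 1.

Definition proper_coloring (c : T -> nat) : Prop :=
  forall u v, adj u v -> c u != c v.

(** The factor is positive even at isolated vertices, so lowering a single color always lowers the
    weight; its growth with the degree makes the exchange in [class2_no_small] profitable. *)
Definition weight (c : T -> nat) : nat := \sum_v c v * (deg v).+1.

(* Rank colors are proper; the slack makes colors 1 and 2 always available. *)
Definition color_bound : nat := #|T|.+3.

Lemma weight_minimizer : exists c : T -> nat,
  [/\ proper_coloring c, forall v, c v < color_bound
    & forall c' : T -> nat, proper_coloring c' ->
        (forall v, c' v < color_bound) -> weight c <= weight c'].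
Proof.
(* Bounding the colors leaves finitely many candidates, so a minimum exists. *)
pose properb (c : {ffun T -> 'I_color_bound}) :=
  [forall u, forall v, adj u v ==> (c u != c v)].
have rank_lt (v : T) : enum_rank v < color_bound.
  exact: leq_trans (ltn_ord (enum_rank v)) (leq_addl 3 _).
pose c0 : {ffun T -> 'I_color_bound} := [ffun v => Ordinal (rank_lt v)].
have c0P : properb c0.
  apply/forallP=> u; apply/forallP=> v; apply/implyP=> uv; rewrite !ffunE.
  apply/eqP=> /(congr1 val) /= /val_inj /enum_rank_inj uv_eq.
  by rewrite uv_eq adj_irr in uv.
case: (arg_minnP (fun c : {ffun T -> 'I_color_bound} => weight (fun v => c v)) c0P) => c cP cmin.
exists (fun v => c v : 'I_color_bound); split=> [u v uv|v|c' c'P c'lt].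
- by move/forallP/(_ u)/forallP/(_ v): cP; rewrite uv.
- exact: ltn_ord.
pose c1 : {ffun T -> 'I_color_bound} := [ffun v => Ordinal (c'lt v)].
have -> : weight c' = weight (fun v => c1 v : 'I_color_bound).
  by apply: eq_bigr => v _; rewrite ffunE.
apply: cmin; apply/forallP=> u; apply/forallP=> v; apply/implyP=> uv.
by rewrite !ffunE -val_eqE /=; apply: c'P.
Qed.

Section Coloring.

Hypothesis deg_le3 : forall v, deg v <= 3.

Variable c : T -> nat.
Hypotheses (c_proper : proper_coloring c) (c_lt : forall v, c v < color_bound).
Hypothesis c_min : forall c' : T -> nat, proper_coloring c' ->
  (forall v, c' v < color_bound) -> weight c <= weight c'.

(** * Color classes among the neighbors under a minimizer *)

Definition nclass (v : T) (i : nat) : nat := \sum_(w | adj v w) (c w == i).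

Lemma nclass_gt0 v w : adj v w -> 0 < nclass v (c w).
Proof. by move=> vw; rewrite /nclass (bigD1 w) //= eqxx. Qed.

Lemma nclass_self v : nclass v (c v) = 0.
Proof.
by apply: big1 => w vw; rewrite eq_sym (negPf (c_proper vw)).
Qed.

Lemma nclass_le1 v w w' : nclass v (c w) <= 1 -> adj v w -> adj v w' ->
  c w' = c w -> w' = w.
Proof.
move=> n1 vw vw' ww'; apply/eqP/contraT=> neq; move: n1.
by rewrite /nclass (bigD1 w) //= (bigD1 w') /= ?vw' // ww' eqxx.
Qed.

(** Otherwise recoloring [v] with [i] stays proper and lowers the weight. *)
Lemma nclass_lower v i : i < c v -> 0 < nclass v i.
Proof.
move=> iv; rewrite lt0n; apply/negP=> /eqP n0.
pose c' w := if w == v then i else c w.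
have ne w : adj v w -> c w != i.
  by move=> vw; apply/eqP=> wi; have := nclass_gt0 vw; rewrite wi n0.
have c'P : proper_coloring c'.
  move=> a b ab; rewrite /c'; case: (eqVneq a v) => [av|_]; case: (eqVneq b v) => [bv|_].
  - by rewrite av bv adj_irr in ab.
  - by rewrite eq_sym ne // -av.
  - by rewrite ne // -bv adj_sym.
  - exact: c_proper.
have c'lt w : c' w < color_bound.
  by rewrite /c'; case: eqP => // _; apply: ltn_trans iv (c_lt v).
have := c_min c'P c'lt; rewrite /weight (bigD1 v) //= [X in _ <= X](bigD1 v) //=.
have -> : \sum_(w | w != v) c' w * (deg w).+1 = \sum_(w | w != v) c w * (deg w).+1.
  by apply: eq_bigr => w /negPf wv; rewrite /c' wv.
rewrite /c' eqxx leq_add2r leq_pmul2r //; lia.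
Qed.

Lemma deg_nclass_le v :
  nclass v 0 + nclass v 1 + nclass v 2 + nclass v 3 <= deg v.
Proof.
rewrite /nclass -!big_split; apply: leq_sum => w _ /=.
by case: (c w) => [|[|[|[|?]]]].
Qed.

(** A color above 3 would require neighbors in four lower classes. *)
Lemma c_le3 v : c v <= 3.
Proof.
have := deg_nclass_le v; have := deg_le3 v; case: leqP => // lt3.
have := @nclass_lower v 0; have := @nclass_lower v 1.
have := @nclass_lower v 2; have := @nclass_lower v 3; lia.
Qed.

Lemma deg_nclass v :
  deg v = nclass v 0 + nclass v 1 + nclass v 2 + nclass v 3.
Proof.
rewrite /nclass -!big_split; apply: eq_bigr => w _ /=.
by case: (c w) (c_le3 w) => [|[|[|[|?]]]].
Qed.

(** * Small neighbors and the red-blue coloring *)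

Definition small_nbr (v : T) : option T :=
  [pick u | adj v u && (c u == 0) && (deg u <= 2)].

Definition has_small (v : T) : bool := small_nbr v != None.

Lemma small_nbrP v u : small_nbr v = Some u ->
  [/\ adj v u, c u = 0 & deg u <= 2].
Proof.
by rewrite /small_nbr; case: pickP => // w /andP[/andP[? /eqP ?] ?] [<-].
Qed.

Lemma has_smallI v u : adj v u -> c u = 0 -> deg u <= 2 -> has_small v.
Proof.
move=> vu u0 du; rewrite /has_small /small_nbr; case: pickP => // /(_ u).
by rewrite vu u0 du.
Qed.

(* Otherwise give [v] color 0 and its neighbor of color 0 and degree at most 2
   a color in {1, 2}: the weight drops, since [v] has the larger degree. *)
Lemma class2_no_small v : c v = 2 -> nclass v 0 = 1 -> deg v = 3 ->
  ~~ has_small v.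
Proof.
move=> v2 nv0 dv; apply/negP; rewrite /has_small.
case E: (small_nbr v) => [u|] // _; have [vu u0 du] := small_nbrP E.
have uv : adj u v by rewrite adj_sym.
have nuv := negPf (c_proper uv).
(* If [u] has no neighbor of class 1, then 1 is free. Otherwise, as [deg u <= 2], [v] is its only
   neighbor of class 2, and 2 becomes free when [v] is recolored. *)
have [t [t0 t2 tP]] : exists t, [/\ 0 < t, t <= 2
    & forall z, adj u z -> z != v -> c z != t].
  have := nclass_gt0 uv; rewrite v2 => nu2.
  have := deg_nclass u => dnu.
  case: (posnP (nclass u 1)) => [nu1|nu1].
    exists 1; split=> // z uz _; apply/eqP=> z1.
    by have := nclass_gt0 uz; rewrite z1 nu1.
  exists 2; split=> // z uz zv; apply/eqP=> z2; case/eqP: zv.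
  by apply: (@nclass_le1 u) => //; rewrite v2 //; lia.
have v_ne_u : v != u by apply/eqP=> e; rewrite e adj_irr in vu.
pose c' w := if w == v then 0 else if w == u then t else c w.
have ne0 z : adj v z -> z != u -> c z != 0.
  move=> vz zu; apply/eqP=> z0; case/eqP: zu.
  by apply: (@nclass_le1 v) => //; rewrite ?u0 ?nv0.
have c'P : proper_coloring c'.
  move=> a b ab; have ba : adj b a by rewrite adj_sym.
  rewrite /c'; case: (eqVneq a v) ab ba => [->|av] ab ba.
    case: (eqVneq b v) ab ba => [->|bv] ab ba; first by rewrite adj_irr in ab.
    case: (eqVneq b u) ab ba => [_|bu] ab ba; first by rewrite eq_sym -lt0n.
    by rewrite eq_sym ne0.
  case: (eqVneq b v) ab ba => [->|bv] ab ba.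
    case: (eqVneq a u) ab ba => [_|au] ab ba; first by rewrite -lt0n.
    by rewrite ne0.
  case: (eqVneq a u) ab ba => [->|au] ab ba.
    case: (eqVneq b u) ab ba => [->|bu] ab ba; first by rewrite adj_irr in ab.
    by rewrite eq_sym tP.
  case: (eqVneq b u) ab ba => [->|bu] ab ba; first by rewrite tP.
  exact: c_proper.
have c'lt w : c' w < color_bound.
  rewrite /c'; case: ifP => // _; case: ifP => // _.
  by rewrite /color_bound; lia.
have := c_min c'P c'lt; rewrite /weight.
rewrite (bigD1 v) // (bigD1 u) 1?eq_sym //=.
rewrite [X in _ <= X](bigD1 v) // [X in _ <= _ + X](bigD1 u) 1?eq_sym //=.
set S := \sum_(w | _) _; set S' := \sum_(w | _) _.
have -> : S' = S.
  by apply: eq_bigr => w /andP[/negPf wv /negPf wu]; rewrite /c' wv wu.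
(* The pair contributed 2 * 4 = 8 to the weight and now contributes at most 2 * 3 = 6. *)
rewrite /c' !eqxx eq_sym (negPf v_ne_u) v2 u0 dv; nia.
Qed.

(* The vertices of class 1 that will have blue total 3. *)
Definition high (v : T) : bool :=
  (c v == 1) && ((nclass v 2 + nclass v 3 == 2) ||
                 (nclass v 2 + nclass v 3 == 1) && has_small v).

Definition high_nbr (v : T) : bool := [exists w, adj v w && high w].

(** Class 1 is settled first. Since switching gives blue total 3, the value at high vertices, a
    class 2 vertex with a high neighbor must not be switched. *)
Definition switched (v : T) : bool :=
  has_small v &&
  ((c v == 1) && (nclass v 2 + nclass v 3 == 1) ||
   [&& c v == 2, nclass v 1 == 1, nclass v 3 == 0 & ~~ high_nbr v]).

(** [small_nbr] fixes one choice, so a switched vertex switches exactly one edge. *)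
Definition switched_edge (v u : T) : bool :=
  switched v && (small_nbr v == Some u).

Definition base_red (i j : nat) : bool :=
  [|| i == 0, j == 0 | (1 < i) && (1 < j)].

Definition red_edge (u v : T) : bool :=
  [&& base_red (c u) (c v), ~~ switched_edge u v & ~~ switched_edge v u].

Definition red_deg (v : T) : nat := \sum_(w | adj v w) red_edge v w.

Definition red_vertex (v : T) : bool :=
  match c v with
  | 0 => red_deg v != 2
  | 1 => (nclass v 2 + nclass v 3 == 0) && (nclass v 0 == 2) ||
         [&& nclass v 2 == 1, nclass v 3 == 0 & ~~ has_small v]
  | 2 => (nclass v 1 == 2) || high_nbr v && (nclass v 0 == 2)
  | _ => true
  end.

Definition red_total v := red_deg v + red_vertex v.
Definition blue_total v := deg v - red_deg v + ~~ red_vertex v.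

(** * Red and blue totals at the ends of an edge *)

Lemma red_edge_sym u v : red_edge u v = red_edge v u.
Proof.
rewrite /red_edge [X in _ && X]andbC; congr (_ && _).
by rewrite /base_red; case: (c u == 0); case: (c v == 0); rewrite //= andbC.
Qed.

Lemma red_deg_le v : red_deg v <= deg v.
Proof. by apply: leq_sum => w _; case: red_edge. Qed.

Lemma switched_small v : switched v -> exists u, small_nbr v = Some u.
Proof.
rewrite /switched /has_small; case: small_nbr => // u _; by exists u.
Qed.

Lemma switched_color v : switched v -> 0 < c v.
Proof. by rewrite /switched lt0n; case: (c v) => //; rewrite andbF. Qed.

(** Outside class 0 a vertex loses a red edge only by its own switch, because switches point into
    class 0. The loss is added on the left to avoid subtraction. *)
Lemma red_deg_pos v : 0 < c v -> red_deg v + switched v =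
  nclass v 0 + (1 < c v) * (nclass v 2 + nclass v 3).
Proof.
move=> cv.
have -> : nat_of_bool (switched v) = \sum_(w | adj v w) switched_edge v w.
  rewrite /switched_edge; case E: (switched v); last by rewrite big1.
  have [u smu] := switched_small E; have [vu _ _] := small_nbrP smu.
  rewrite (bigD1 u) //= smu eqxx big1 // => w /andP[_ wu].
  by apply/eqP; rewrite eqb0; apply: contra wu => /eqP [->].
rewrite /nclass -!big_split big_distrr /= -big_split; apply: eq_bigr => w vw /=.
have -> : red_edge v w = base_red (c v) (c w) && ~~ switched_edge v w.
  rewrite /red_edge; case E: (switched_edge w v); last by rewrite andbT.
  case/andP: E => _ /eqP/small_nbrP[_ v0 _]; by rewrite v0 in cv.
case E: (switched_edge v w).
  case/andP: E => _ /eqP/small_nbrP[_ -> _].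
  by rewrite /base_red orbT /= muln0.
rewrite andbT addn0 /base_red; move: (c_le3 w) cv.
by case: (c w) => [|[|[|[|?]]]] //; case: (c v) => [|[|?]].
Qed.

Lemma class0_red_deg u : c u = 0 -> 2 < deg u -> red_deg u = deg u.
Proof.
move=> u0 du; apply: eq_bigr => w uw; rewrite /red_edge /base_red u0 /=.
case E: (switched_edge u w).
  by case/andP: E => /switched_color; rewrite u0.
case E': (switched_edge w u) => //.
by case/andP: E' => _ /eqP/small_nbrP[_ _]; rewrite leqNgt du.
Qed.

(** Coloring the vertex red unless its red degree is 2 lifts red degree 1 to 2 and 3 to 4. A blue
    edge forces degree at most 2 and red degree at most 1, so the vertex itself is red and adds
    nothing to the blue total. *)
Lemma total_class0 u v : c u = 0 -> adj u v ->
  if red_edge u v then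
    red_total u = (if deg u <= 2 then 2 else 4)
  else blue_total u <= 2 /\ deg u <= 2.
Proof.
move=> u0 uv.
rewrite /red_total /blue_total /red_vertex u0.
have := red_deg_le u; have := deg_le3 u.
have dle := class0_red_deg u0.
have: if red_edge u v then 0 < red_deg u else red_deg u < deg u.
  case E: (red_edge u v).
    by rewrite /red_deg (bigD1 v) //= E.
  rewrite /red_deg /deg (bigD1 v) //= [X in _ < X](bigD1 v) //= E.
  by rewrite add0n add1n ltnS; apply: leq_sum => w _; case: red_edge.
by case: (red_edge u v); case: (leqP (deg u) 2) => du; lia.
Qed.

(** In class 2, two neighbors of class 1 or one of class 3 force degree 3 with a single class 0
    neighbor, so [class2_no_small] applies. The remaining patterns of red total 2 with a small
    neighbor are removed by switching or by a red vertex. *)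
Lemma total_pos v : 0 < c v ->
  [/\ red_total v <= 3, has_small v -> red_total v != 2
    & switched v -> blue_total v = 3].
Proof.
move=> v0; have := red_deg_pos v0; have := deg_nclass v; have := deg_le3 v.
have := class2_no_small (v := v).
have := nclass_lower v0; have := nclass_self v.
have := @nclass_lower v 1; have := @nclass_lower v 2.
rewrite /red_total /blue_total /red_vertex /switched.
have := c_le3 v; move: v0.
case: (c v) => [|[|[|[|?]]]] //=;
  move: (red_deg v) (deg v) (nclass v 0) (nclass v 1) (nclass v 2) (nclass v 3);
  move=> r d n0 n1 n2 n3; case: (has_small v); case: (high_nbr v);
  rewrite ?andbF ?andbT ?orbF /=; split; lia.
Qed.

(** Here [v] has blue total 3 if high and 1 otherwise. Two class 1 neighbors give [w] blue total 2;
    if [v] is the only one, [w] has at most 2 when [v] is high and at least 2 when it is not. *)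
Lemma blue_total12 v w : c v = 1 -> c w = 2 -> adj v w ->
  blue_total v != blue_total w.
Proof.
move=> v1 w2 vw; have wv : adj w v by rewrite adj_sym.
have v0 : 0 < c v by rewrite v1.
have w0 : 0 < c w by rewrite w2.
have hN : nclass w 1 <= 1 -> high_nbr w = high v.
  move=> le1; apply/existsP/idP => [[v' /andP[wv' hv']]|hv]; last first.
    by exists v; rewrite wv.
  suff <- : v' = v by [].
  apply: (@nclass_le1 w) => //; rewrite v1 //.
  by case/andP: hv' => /eqP.
have := nclass_gt0 vw; have := nclass_gt0 wv; rewrite v1 w2.
have := red_deg_pos v0; have := deg_nclass v; have := deg_le3 v.
have := red_deg_pos w0; have := deg_nclass w; have := deg_le3 w.
have := class2_no_small w2; move: hN.
have := nclass_lower v0; have := nclass_self v.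
have := nclass_lower w0; have := nclass_self w.
rewrite /blue_total /red_vertex /switched /high v1 w2 /=.
move: (red_deg v) (deg v) (nclass v 0) (nclass v 1) (nclass v 2) (nclass v 3).
move=> r d n0 n1 n2 n3.
move: (red_deg w) (deg w) (nclass w 0) (nclass w 1) (nclass w 2) (nclass w 3).
move=> r' d' n0' n1' n2' n3'.
case: (has_small v); case: (high_nbr w); case: (has_small w);
  rewrite ?andbF ?andbT ?orbF /=; lia.
Qed.

(** The class 3 end has one neighbor in each lower class and blue total 1; its presence keeps the
    vertex [v] blue, with blue total at least 2. *)
Lemma blue_total13 v w : c v = 1 -> c w = 3 -> adj v w ->
  blue_total v != blue_total w.
Proof.
move=> v1 w3 vw.
have v0 : 0 < c v by rewrite v1.
have w0 : 0 < c w by rewrite w3.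
have := nclass_gt0 vw; rewrite w3.
have := red_deg_pos v0; have := deg_nclass v; have := deg_le3 v.
have := red_deg_pos w0; have := deg_nclass w; have := deg_le3 w.
have := nclass_lower v0; have := nclass_self v.
have := @nclass_lower w 0; have := @nclass_lower w 1; have := @nclass_lower w 2.
rewrite /blue_total /red_vertex /switched v1 w3 /=.
case: (has_small v) => /=; lia.
Qed.

(** Both neighborhoods are forced: the red totals are 2 at [v] and 3 at [w]. *)
Lemma red_total23 v w : c v = 2 -> c w = 3 -> adj v w ->
  red_total v != red_total w.
Proof.
move=> v2 w3 vw.
have v0 : 0 < c v by rewrite v2.
have w0 : 0 < c w by rewrite w3.
have := nclass_gt0 vw; rewrite w3.
have := red_deg_pos v0; have := deg_nclass v; have := deg_le3 v.
have := red_deg_pos w0; have := deg_nclass w; have := deg_le3 w.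
have := @nclass_lower v 0; have := @nclass_lower v 1.
have := @nclass_lower w 0; have := @nclass_lower w 1; have := @nclass_lower w 2.
rewrite /red_total /red_vertex /switched v2 w3 /=; lia.
Qed.

Lemma total_neq u v : adj u v ->
  if red_edge u v then red_total u != red_total v
  else blue_total u != blue_total v.
Proof.
wlog uv_le : u v / c u <= c v.
  move=> W uv; case: (leqP (c u) (c v)) => le; first exact: W.
  have := W v u (ltnW le); rewrite adj_sym uv red_edge_sym => /(_ isT).
  by case: ifP => _; rewrite eq_sym.
move=> uv; have uv_lt : c u < c v by rewrite ltn_neqAle c_proper.
case: (posnP (c u)) => [u0|u_gt0].
  have := total_class0 u0 uv.
  have [Rv3 Rv2 Bv] := total_pos (leq_ltn_trans (leq0n _) uv_lt).
  case E: (red_edge u v).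
    case: leqP => du ->; last by rewrite eq_sym neq_ltn (leq_ltn_trans Rv3).
    by rewrite eq_sym Rv2 // (@has_smallI v u) // adj_sym.
  (* A blue edge at class 0 can only be the switched edge of [v], so [v] has blue total 3. *)
  case=> Bu _; rewrite neq_ltn Bv; first by rewrite ltnS Bu.
  move: E; rewrite /red_edge /base_red u0 /=.
  rewrite {1}/switched_edge; case E: (switched u).
    by have := switched_color E; rewrite u0.
  by rewrite /= /switched_edge; case: (switched v).
have -> : red_edge u v = (1 < c u).
  rewrite /red_edge /base_red.
  have no_sw x y : 0 < c y -> ~~ switched_edge x y.
    by move=> y0; apply/negP=> /andP[_ /eqP/small_nbrP[_ /eqP]]; rewrite -leqn0 leqNgt y0.
  rewrite !no_sw ?(ltn_trans u_gt0 uv_lt) // !andbT; lia.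
have := c_le3 v; move: uv_lt u_gt0.
case cu: (c u) => [|[|[|[|?]]]] //; case cv: (c v) => [|[|[|[|?]]]] //= _ _ _.
- exact: blue_total12.
- exact: blue_total13.
- exact: red_total23.
Qed.

End Coloring.

(** Here [true] stands for red; coloring ordered pairs symmetrically postpones the treatment of
    edges as sets. *)
Lemma locally_irregular_bicoloring : (forall v, deg v <= 3) ->
  exists (x : T -> bool) (y : T -> T -> bool),
    (forall u v, y u v = y v u) /\
    forall u v, adj u v ->
      \sum_(w | adj u w) (y u w == y u v) + (x u == y u v) !=
      \sum_(w | adj v w) (y v w == y u v) + (x v == y u v).
Proof.
move=> le3; have [c [cP c_lt c_min]] := weight_minimizer.
exists (red_vertex c), (red_edge c); split; first exact: red_edge_sym.
have E u b : \sum_(w | adj u w) (red_edge c u w == b) + (red_vertex c u == b) =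
    if b then red_total c u else blue_total c u.
  case: b; rewrite /red_total /blue_total.
    by congr (_ + _); [apply: eq_bigr => w _|]; rewrite eqb_id.
  congr (_ + _); last by rewrite eqbF_neg.
  apply/eqP; rewrite -(eqn_add2r (red_deg c u)) subnK ?red_deg_le //.
  rewrite /red_deg -big_split; apply/eqP/eq_bigr => w _ /=.
  by case: red_edge.
move=> u v uv; rewrite !E; have := total_neq le3 cP c_lt c_min uv.
by case: red_edge.
Qed.

End Relation.

(** * Transfer from relations to graphs *)

Section Graph.

Variable G : sgraph.

Definition adjacent (u v : G) : bool := [set u; v] \in edges G.

Lemma adjacent_sym : symmetric adjacent.
Proof. by move=> u v; rewrite /adjacent setUC. Qed.

Lemma adjacent_irr : irreflexive adjacent.
Proof.
move=> u; apply/negP=> /edges_card2; by rewrite setUid cards1.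
Qed.

(** The map from [w] to [[set v; w]] is a bijection from the neighbors of [v] to its edges. A
    trivial [P] gives degrees, a color class gives totals. *)
Lemma card_incident (v : G) (P : pred {set G}) :
  #|[set e : edge G | (v \in val e) && P (val e)]| =
  \sum_(w | adjacent v w) P [set v; w].
Proof.
rewrite -(card_imset _ val_inj) -big_mkcondr sum1dep_card.
rewrite -(@card_in_imset _ _ (fun w => [set v; w])); last first.
  move=> w w'; rewrite !inE => /andP[vw _] _ eqww'.
  have : w \in [set v; w'] by rewrite -eqww' set22.
  case/set2P=> // wv; by rewrite wv adjacent_irr in vw.
apply: eq_card => e; apply/imsetP/imsetP => [[e'] | [w]].
  rewrite inE => /andP[ve Pe] ->.
  have /eqP/cards2P[a [b [_ e'E]]] := edges_card2 (valP e').
  have := valP e'; rewrite e'E in ve Pe *.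
  case/set2P: ve Pe => -> Pe e'in.
    by exists b; rewrite // inE /adjacent e'in.
  by exists a; rewrite 1?setUC // inE /adjacent setUC e'in.
rewrite inE => /andP[vw Pw] ->.
by exists (Sub [set v; w] vw); rewrite // inE /= set21.
Qed.

Lemma degree_adjacent (v : G) : degree v = deg adjacent v.
Proof.
rewrite /deg -(card_incident v predT).
by apply: eq_card => e; rewrite !inE andbT.
Qed.

End Graph.

Theorem theorem2 (G : sgraph) : subcubic G -> tlir G <= 2.
Proof.
move=> sub; rewrite /tlir; case: ex_minnP => m _; apply.
have le3 (v : G) : deg (@adjacent G) v <= 3.
  rewrite -degree_adjacent; apply: leq_trans sub.
  exact: (leq_bigmax (F := fun v : G => degree v)).
have [x [y [y_sym xyP]]] :=
  locally_irregular_bicoloring (@adjacent_sym G) (@adjacent_irr G) le3.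
pose col (b : bool) : 'I_2 := if b then ord0 else ord_max.
have col_inj b b' : (col b == col b') = (b == b') by case: b; case: b'.
(* Quantifying over both orders of the ends avoids choosing one; [y_sym] makes the value
   unambiguous. *)
pose Y (e : {set G}) := [exists u, exists v, (e == [set u; v]) && y u v].
have YE u v : adjacent u v -> Y [set u; v] = y u v.
  move=> uv; apply/existsP/idP => [[a /existsP[b /andP[/eqP E yab]]] | yuv].
    have : u \in [set a; b] by rewrite -E set21.
    have : v \in [set a; b] by rewrite -E set22.
    case/set2P=> vE; case/set2P=> uE; rewrite uE vE // in uv *.
    - by rewrite adjacent_irr in uv.
    - by rewrite y_sym.
    - by rewrite adjacent_irr in uv.
  by exists u; apply/existsP; exists v; rewrite eqxx.
pose f : total_coloring G 2 :=
  [ffun t => match t with inl v => col (x v) | inr e => col (Y (val e)) end].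
apply/existsP; exists f.
apply/forallP=> e; apply/forallP=> u; apply/forallP=> v; apply/implyP=> /eqP eE.
have uv : adjacent u v by rewrite /adjacent -eE (valP e).
have fE t : total_cdegree f (f (inr e)) t =
    \sum_(w | adjacent t w) (y t w == y u v) + (x t == y u v).
  rewrite /total_cdegree !ffunE eE YE // col_inj; congr (_ + _).
  under [RHS]eq_bigr => w tw do rewrite -YE //.
  rewrite -(card_incident t (fun e => Y e == y u v)).
  by apply: eq_card => d; rewrite !inE ffunE col_inj.
by rewrite !fE xyP.
Qed.
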